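(* Let $(A,B,C)\neq(6,7,10)$ be a nontrivial solution triple of $A!\,B!=C!$. Then: (i) For every real number $t>-1-\frac{1+2\log\log 2}{\log 2}=-1.3851\dots$ there exists $B_0=B_0(t)$ such that every such nontrivial solution with $B\ge B_0$ satisfies $$A\le \frac{\log(B+1)}{\log2}+\frac{2\log\log(B+1)}{\log2}+t.$$ (ii) Every such nontrivial solution satisfies $$A\le \frac{\log(B+1)}{\log2}+\frac{2\log\log(B+1)}{\log2}+2.1221.$$
   Context: A nontrivial solution triple of the equation $A!\,B!=C!$ is a triple of positive integers $(A,B,C)$ with $A\le B\le C-2$ satisfying $A!\,B!=C!$. Here $\log$ denotes the natural logarithm. *)

(* Defs.v *)
From Stdlib Require Import Factorial Reals.
Open Scope R_scope.

Definition nontrivial_solution (A B C : nat) : Prop :=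
  (0 < A)%nat /\ (0 < B)%nat /\ (0 < C)%nat /\
  (A <= B)%nat /\ (B + 2 <= C)%nat /\
  (fact A * fact B)%nat = fact C.

Definition t_inf : R := -1 - (1 + 2 * ln (ln 2)) / ln 2.

Definition upper_bound (B : nat) (t : R) : R :=
  ln (INR B + 1) / ln 2 + 2 * ln (ln (INR B + 1)) / ln 2 + t.

(* Main.v *)
(* If A! B! = C! and k = C - B, then A! is the product of the k consecutive
   integers B+1, ..., B+k. Legendre's formula compares 2-adic valuations:
   A - log2 (A+1) <= v2 (A!) <= (k - 2) + log2 C with C <= 2 (B+1), so
   k >= n - a - x where
   n = A + 1, a = log2 n and x = log2 (B+1). On the other hand (B+1)^k <= A!, so
   k x <= log2 (A!) <= n a - (n - 1) / ln 2. Combining the two and factoring,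
     (x - a) (n - x - 2 a) <= 2 a^2 - (n - 1) / ln 2.
   The right-hand side is negative for n >= 49, whence n < x + 2 log2 n, and
   then n <= 2 x gives (ii); keeping the term (n - 1) / ln 2 gives (i).
   For A < 48 a computation shows that (6, 7, 10) is the only solution. *)
Require Import Defs.
From Stdlib Require Import Arith Lia ZArith NArith ZifyNat List Bool.
From Stdlib Require Import Reals Lra Psatz Factorial.
From Coquelicot Require Import Coquelicot.
Ltac Zify.zify_post_hook ::= Z.to_euclidean_division_equations.
Open Scope nat_scope.

(** * Legendre's formula and the 2-adic valuation of factorials *)

(** Legendre's sum n/2 + n/4 + ... with rounding down; fuel [n] suffices because halving decreases
    every positive number. *)
Fixpoint halves_sum (fuel n : nat) : nat :=
  match fuel with
  | O => O
  | S fuel' => n / 2 + halves_sum fuel' (n / 2)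
  end.

Definition v2fact (n : nat) : nat := halves_sum n n.

Lemma halves_sum_fuel (f g n : nat) :
  n <= f -> n <= g -> halves_sum f n = halves_sum g n.
Proof.
  assert (H0 : forall h, halves_sum h 0 = 0).
  { intros h. induction h as [|h IH]; [reflexivity|exact IH]. }
  revert g n; induction f as [|f IH]; intros g n Hf Hg.
  - replace n with 0 by lia. now rewrite !H0.
  - destruct g as [|g].
    + replace n with 0 by lia. now rewrite !H0.
    + cbn [halves_sum]. f_equal. apply IH; lia.
Qed.

Lemma v2fact_half (n : nat) : v2fact n = n / 2 + v2fact (n / 2).
Proof.
  destruct n as [|n]; [reflexivity|].
  unfold v2fact at 1. cbn [halves_sum]. f_equal. apply halves_sum_fuel; lia.
Qed.

Lemma half_ind (P : nat -> Prop) :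
  P 0 -> (forall n, 0 < n -> P (n / 2) -> P n) -> forall n, P n.
Proof.
  intros H0 HS n. induction n as [n IH] using (well_founded_induction lt_wf).
  destruct (Nat.eq_dec n 0) as [->|Hn]; [exact H0|].
  apply HS; [lia|]. apply IH. lia.
Qed.

(** The even factors of (2m)! multiply to 2^m m!, and the odd ones to [o]. *)
Lemma fact_double (m : nat) :
  exists o, Nat.Odd o /\ fact (2 * m) = 2 ^ m * fact m * o.
Proof.
  induction m as [|m [o [Ho IH]]].
  - exists 1. split; [now exists 0|reflexivity].
  - exists ((2 * m + 1) * o). split.
    + apply Nat.Odd_mul; [now exists m|exact Ho].
    + replace (2 * S m) with (S (S (2 * m))) by lia.
      rewrite !fact_simpl, IH, Nat.pow_succ_r'. ring.
Qed.

Lemma fact_v2 (n : nat) : exists o, Nat.Odd o /\ fact n = 2 ^ v2fact n * o.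
Proof.
  induction n as [|n Hn [o [Ho IH]]] using half_ind.
  - exists 1. split; [now exists 0|reflexivity].
  - destruct (fact_double (n / 2)) as [o' [Ho' E]].
    rewrite v2fact_half, Nat.pow_add_r.
    destruct (Nat.Even_or_Odd n) as [[m Hm]|[m Hm]].
    + assert (Hd : n / 2 = m) by lia. rewrite Hd in *.
      exists (o * o'). split; [now apply Nat.Odd_mul|].
      rewrite Hm at 1. rewrite E, IH. ring.
    + assert (Hd : n / 2 = m) by lia. rewrite Hd in *.
      exists (n * (o * o')). split.
      * apply Nat.Odd_mul; [now exists m|now apply Nat.Odd_mul].
      * replace n with (S (2 * m)) at 1 by lia.
        rewrite fact_simpl, E, IH.
        replace n with (S (2 * m)) by lia. ring.
Qed.

Lemma pow2_odd_inj (a b o p : nat) :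
  Nat.Odd o -> Nat.Odd p -> 2 ^ a * o = 2 ^ b * p -> a = b.
Proof.
  intros [o' Ho] [p' Hp]. revert b. induction a as [|a IH]; intros [|b] E;
    rewrite ?Nat.pow_succ_r', ?Nat.pow_0_r in E; try lia.
  f_equal. apply IH. lia.
Qed.

Lemma v2fact_mul (A B C : nat) :
  fact A * fact B = fact C -> v2fact A + v2fact B = v2fact C.
Proof.
  intros E.
  destruct (fact_v2 A) as [a [Ha Ea]], (fact_v2 B) as [b [Hb Eb]],
    (fact_v2 C) as [c [Hc Ec]].
  apply (pow2_odd_inj _ _ (a * b) c); [now apply Nat.Odd_mul|exact Hc|].
  rewrite <- Ec, <- E, Ea, Eb, Nat.pow_add_r. ring.
Qed.

Lemma v2fact_le (n : nat) : v2fact n <= n - 1.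
Proof.
  induction n as [|n Hn IH] using half_ind; [auto|].
  rewrite v2fact_half. destruct (Nat.eq_dec n 1) as [->|Hn1]; [cbn; lia|].
  lia.
Qed.

Lemma v2fact_mono (m n : nat) : m <= n -> v2fact m <= v2fact n.
Proof.
  revert m. induction n as [|n Hn IH] using half_ind; intros m Hm.
  - replace m with 0 by lia. auto.
  - rewrite (v2fact_half m), (v2fact_half n).
    assert (m / 2 <= n / 2) by (apply Nat.Div0.div_le_mono; lia).
    specialize (IH _ H). lia.
Qed.

(** An exponential form of n - log2 (n+1) <= v2 (n!). With m = n / 2, multiply the bound for m by
    2^m if n is even and by 2^(m+1) if n is odd; then m + 1 <= 2m + 1, respectively 2 (m + 1) = n +
    1. *)
Lemma v2fact_lower (n : nat) : 2 ^ n <= (n + 1) * 2 ^ v2fact n.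
Proof.
  induction n as [|n Hn IH] using half_ind; [cbn; lia|].
  rewrite v2fact_half, Nat.pow_add_r.
  destruct (Nat.Even_or_Odd n) as [[m Hm]|[m Hm]];
    assert (Hd : n / 2 = m) by lia; rewrite Hd in *; rewrite Hm.
  - replace (2 * m) with (m + m) at 1 by lia. rewrite Nat.pow_add_r. nia.
  - replace (2 * m + 1) with (S (m + m)) at 1 by lia.
    rewrite Nat.pow_succ_r', Nat.pow_add_r. nia.
Qed.

(* Legendre: floor((b+j+1)/q) <= floor(b/q) + floor(j/q) + 1 for each q = 2^i,
   and the term vanishes once q > b+j+1. *)
Lemma v2fact_add (b j : nat) :
  v2fact (b + j + 1) <= v2fact b + v2fact j + Nat.log2 (b + j + 1).
Proof.
  remember (b + j + 1) as c eqn:Hc. revert b j Hc.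
  induction c as [|c Hc0 IH] using half_ind; intros b j Hc; [cbn; lia|].
  destruct (Nat.eq_dec c 1) as [->|Hc1]; [cbn; lia|].
  rewrite (v2fact_half c), (v2fact_half b), (v2fact_half j).
  assert (Hlog : Nat.log2 c = S (Nat.log2 (c / 2))).
  { destruct (Nat.Even_or_Odd c) as [[m Hm]|[m Hm]];
      assert (Hd : c / 2 = m) by lia; rewrite Hd; rewrite Hm.
    - apply Nat.log2_double; lia.
    - apply Nat.log2_succ_double; lia. }
  rewrite Hlog.
  destruct (Nat.eq_dec (c / 2) (b / 2 + j / 2 + 1)) as [E|E].
  - specialize (IH _ _ E). lia.
  (* Here [b] and [j] are even. One unit is taken out of [j / 2] to recover the shape b + j + 1 of
     the induction hypothesis, and monotonicity restores it. *)
  - assert (E' : c / 2 = b / 2 + j / 2) by lia.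
    destruct (Nat.eq_dec (j / 2) 0) as [Hj|Hj].
    + rewrite Hj. replace (c / 2) with (b / 2) by lia. lia.
    + assert (E2 : c / 2 = b / 2 + (j / 2 - 1) + 1) by lia.
      specialize (IH _ _ E2).
      assert (M := v2fact_mono (j / 2 - 1) (j / 2) ltac:(lia)). lia.
Qed.

(** * Size and valuation constraints on k = C - B *)

Lemma fact_add_ge (b k : nat) : fact b * (b + 1) ^ k <= fact (b + k).
Proof.
  induction k as [|k IH].
  - rewrite Nat.add_0_r. cbn. lia.
  - replace (b + S k) with (S (b + k)) by lia. rewrite fact_simpl, Nat.pow_succ_r'. nia.
Qed.

Lemma fact_le_pow (n : nat) : fact n <= n ^ n.
Proof.
  assert (H : forall m, n <= m -> fact n <= m ^ n).
  { induction n as [|n IH]; intros m Hm; [cbn; lia|].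
    rewrite fact_simpl, Nat.pow_succ_r'. apply Nat.mul_le_mono; [lia|].
    apply IH; lia. }
  apply H; lia.
Qed.

Lemma solution_pow_le (A B k : nat) :
  fact A * fact B = fact (B + k) -> (B + 1) ^ k <= fact A.
Proof.
  intros E. assert (H := fact_add_ge B k). assert (P := lt_O_fact B). nia.
Qed.

(** (B+1)^k <= A! <= A^A < (B+1)^A. This leaves finitely many k for each A. *)
Lemma solution_k_lt (A B k : nat) :
  0 < A -> A <= B -> fact A * fact B = fact (B + k) -> k < A.
Proof.
  intros HA HAB E. apply solution_pow_le in E.
  assert (H1 := fact_le_pow A).
  assert (H2 : A ^ A < (B + 1) ^ A) by (apply Nat.pow_lt_mono_l; lia).
  apply (Nat.pow_lt_mono_r_iff (B + 1)); lia.
Qed.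

(** v2 (A!) = v2 ((B+k)!) - v2 (B!), which [v2fact_add] with j = k - 1 bounds by v2 ((k-1)!) + log2
    (B+k), and v2 ((k-1)!) <= k - 2. *)
Lemma solution_v2 (A B k : nat) :
  2 <= k -> fact A * fact B = fact (B + k) ->
  2 ^ v2fact A <= 2 ^ (k - 2) * (B + k).
Proof.
  intros Hk E. apply v2fact_mul in E.
  assert (H := v2fact_add B (k - 1)).
  replace (B + (k - 1) + 1) with (B + k) in H by lia.
  assert (H1 := v2fact_le (k - 1)).
  assert (H2 := proj1 (Nat.log2_spec (B + k) ltac:(lia))).
  apply Nat.le_trans with (2 ^ (k - 2 + Nat.log2 (B + k))).
  - apply Nat.pow_le_mono_r; lia.
  - rewrite Nat.pow_add_r. apply Nat.mul_le_mono_l. exact H2.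
Qed.

(** * Computer search for A < 48 *)

(** The product (b+1)...(b+k), in binary so that numbers as large as 47! can be computed. *)
Fixpoint rising (b : N) (k : nat) : N :=
  match k with
  | O => 1%N
  | S k' => (rising b k' * (b + N.of_nat k))%N
  end.

Lemma fact_rising (b k : nat) :
  N.of_nat (fact (b + k)) = (N.of_nat (fact b) * rising (N.of_nat b) k)%N.
Proof.
  induction k as [|k IH].
  - rewrite Nat.add_0_r. cbn [rising]. lia.
  - replace (b + S k) with (S (b + k)) by lia.
    rewrite fact_simpl, Nat2N.inj_mul, IH. cbn [rising].
    replace (N.of_nat (S (b + k))) with (N.of_nat b + N.of_nat (S k))%N by lia.
    ring.
Qed.

Lemma rising_mono (b c : N) (k : nat) : (b <= c)%N -> (rising b k <= rising c k)%N.
Proof.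
  intros H. induction k as [|k IH]; cbn [rising]; [lia|].
  apply N.mul_le_mono; lia.
Qed.

(** Bisection on [lo, hi) for [rising b k = F], correct because [rising] is monotone in b. Exhausted
    fuel on a nonempty interval returns [false], so [true] is always conclusive. *)
Fixpoint no_root (fuel : nat) (F : N) (k : nat) (lo hi : N) : bool :=
  if (hi <=? lo)%N then true else
  match fuel with
  | O => false
  | S fuel' =>
      let m := ((lo + hi) / 2)%N in
      match (rising m k ?= F)%N with
      | Eq => false
      | Lt => no_root fuel' F k (m + 1)%N hi
      | Gt => no_root fuel' F k lo m
      end
  end.

Lemma no_root_sound (fuel : nat) (F : N) (k : nat) (lo hi b : N) :
  0 < k -> no_root fuel F k lo hi = true ->
  (lo <= b < hi)%N -> rising b k <> F.
Proof.
  intros Hk. revert lo hi.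
  induction fuel as [|fuel IH]; intros lo hi; cbn [no_root];
    destruct (N.leb_spec hi lo) as [Hle|Hlt]; try (intros; lia); try discriminate.
  destruct (N.compare_spec (rising ((lo + hi) / 2) k) F) as [E|E|E];
    intros Hrun Hb HF; [discriminate| |].
  - apply (IH _ _ Hrun); [|exact HF]. split; [|lia].
    destruct (N.le_gt_cases b ((lo + hi) / 2)) as [Hc|Hc]; [|lia].
    apply (rising_mono _ _ k) in Hc. lia.
  - apply (IH _ _ Hrun); [|exact HF]. split; [lia|].
    destruct (N.le_gt_cases ((lo + hi) / 2) b) as [Hc|Hc]; [|lia].
    apply (rising_mono _ _ k) in Hc. lia.
Qed.

Lemma solution_lower (A B k : nat) :
  2 <= k -> fact A * fact B = fact (B + k) ->
  (2 ^ N.of_nat (v2fact A + 2 - k) - N.of_nat k <= N.of_nat B)%N.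
Proof.
  intros Hk E. assert (H := solution_v2 A B k Hk E).
  assert (H2 : 2 ^ (v2fact A + 2 - k) <= B + k).
  (* If v2 (A!) + 2 <= k, the truncated exponent is 0 and only 1 <= B + k is claimed; otherwise
     2^(k-2) is cancelled in [solution_v2]. *)
  { destruct (Nat.le_gt_cases (v2fact A + 2) k) as [Hc|Hc].
    - replace (v2fact A + 2 - k) with 0 by lia. cbn. lia.
    - replace (v2fact A) with ((k - 2) + (v2fact A + 2 - k)) in H at 1 by lia.
      rewrite Nat.pow_add_r in H.
      apply Nat.mul_le_mono_pos_l in H; [exact H|].
      assert (2 ^ (k - 2) <> 0) by (apply Nat.pow_nonzero; lia). lia. }
  replace 2%N with (N.of_nat 2) by reflexivity.
  rewrite <- Nat2N.inj_pow. lia.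
Qed.

(** A bound on the k-th root from bit lengths: k (log2 F / k + 1) >= log2 F + 1, so a larger b would
    make (b+1)^k exceed F. *)
Lemma pow_le_upper (b k F : N) :
  (0 < k)%N -> (0 < F)%N -> ((b + 1) ^ k <= F)%N -> (b < 2 ^ (N.log2 F / k + 1))%N.
Proof.
  intros Hk HF H.
  destruct (N.le_gt_cases (2 ^ (N.log2 F / k + 1)) b) as [Hc|Hc];
    [exfalso|exact Hc].
  assert (H2 := proj2 (N.log2_spec F HF)).
  assert (H3 : (N.succ (N.log2 F) <= (N.log2 F / k + 1) * k)%N).
  { assert (D := N.div_mod (N.log2 F) k ltac:(lia)).
    assert (M := N.mod_lt (N.log2 F) k ltac:(lia)). nia. }
  apply (N.pow_le_mono_r 2) in H3; [|lia]. rewrite N.pow_mul_r in H3.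
  assert (H4 : ((2 ^ (N.log2 F / k + 1)) ^ k <= (b + 1) ^ k)%N)
    by (apply N.pow_le_mono_l; lia).
  lia.
Qed.

Lemma rising_0 (n : nat) : rising 0 n = N.of_nat (fact n).
Proof.
  assert (H := fact_rising 0 n). rewrite Nat.add_0_l in H. rewrite H.
  apply eq_sym, N.mul_1_l.
Qed.

(* The left end of the search interval comes from [solution_lower], the right
   end from [solution_pow_le]; for most pairs the interval is empty. *)
Definition no_solution (fuel A v : nat) (F : N) (k : nat) : bool :=
  no_root fuel F k
    (N.max (N.of_nat A) (2 ^ N.of_nat (v + 2 - k) - N.of_nat k))
    (2 ^ (N.log2 F / N.of_nat k + 1)).

Lemma no_solution_sound (fuel A B k : nat) :
  2 <= k -> A <= B -> no_solution fuel A (v2fact A) (rising 0 A) k = true ->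
  fact A * fact B <> fact (B + k).
Proof.
  intros Hk HAB Hrun E. unfold no_solution in Hrun.
  apply (no_root_sound _ _ _ _ _ (N.of_nat B)) in Hrun; [|lia|split].
  - apply Hrun. rewrite rising_0.
    assert (H := fact_rising B k). rewrite <- E, Nat2N.inj_mul in H.
    assert (P := lt_O_fact B). nia.
  - assert (H := solution_lower A B k Hk E). lia.
  - rewrite rising_0. assert (P := lt_O_fact A). apply pow_le_upper; [lia|lia|].
    assert (H := solution_pow_le A B k E).
    replace (N.of_nat B + 1)%N with (N.of_nat (B + 1)) by lia.
    rewrite <- Nat2N.inj_pow. lia.
Qed.

(** The pair (6, 3) is left out because 6! = 8 * 9 * 10. As 47! < 2^198 and k >= 2, the intervals
    have length at most 2^99, so fuel 400 is ample. *)
Lemma no_small_solution (A k : nat) :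
  A < 48 -> 2 <= k < A -> (A, k) <> (6, 3) -> no_solution 400 A (v2fact A) (rising 0 A) k = true.
Proof.
  intros HA Hk Hne.
  assert (H : forallb (fun A =>
      let v := v2fact A in let F := rising 0 A in
      forallb (fun k => (Nat.eqb A 6 && Nat.eqb k 3) || no_solution 400 A v F k)
        (seq 2 (A - 2))) (seq 0 48) = true) by (vm_compute; reflexivity).
  rewrite forallb_forall in H. specialize (H A).
  rewrite in_seq in H. specialize (H ltac:(lia)). cbv zeta in H.
  rewrite forallb_forall in H. specialize (H k).
  rewrite in_seq in H. specialize (H ltac:(lia)).
  apply orb_prop in H as [H|H]; [|exact H].
  apply andb_prop in H as [H1 H2].
  apply Nat.eqb_eq in H1, H2. subst. now destruct Hne.
Qed.

Lemma nontrivial_solution_large (A B C : nat) :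
  nontrivial_solution A B C -> (A, B, C) <> (6, 7, 10) -> 48 <= A.
Proof.
  intros (HA & _ & _ & HAB & HBC & E) Hne.
  destruct (Nat.le_gt_cases 48 A) as [|Hlt]; [assumption|exfalso].
  remember (C - B) as k eqn:Hk. replace C with (B + k) in * by lia.
  assert (HkA := solution_k_lt A B k HA HAB E).
  assert (HAk : A = 6 /\ k = 3).
  { destruct (Nat.eq_dec A 6) as [HA6|HA6], (Nat.eq_dec k 3) as [Hk3|Hk3];
      try (split; assumption); exfalso;
      refine (no_solution_sound _ _ B k _ HAB (no_small_solution _ _ Hlt _ _) E);
      try lia; intros He; injection He; lia. }
  clear Hk. destruct HAk as [-> ->].
  (* (B+1)^3 <= 720 < 9^3 leaves B = 7, the excluded triple, and B = 6, refuted by computation. *)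
  assert (H := solution_pow_le 6 B 3 E). change (fact 6) with 720 in H.
  assert (HB : B <= 7).
  { destruct (Nat.le_gt_cases B 7) as [|Hc]; [assumption|exfalso].
    assert (9 ^ 3 <= (B + 1) ^ 3) by (apply Nat.pow_le_mono_l; lia).
    change (9 ^ 3) with 729 in *. lia. }
  destruct (Nat.eq_dec B 7) as [->|H7]; [now apply Hne|].
  replace B with 6 in E by lia.
  apply (f_equal N.of_nat) in E. rewrite fact_rising, Nat2N.inj_mul in E.
  vm_compute in E. discriminate.
Qed.

Open Scope R_scope.

(** * Numerical and elementary bounds on logarithms *)

Definition log2R (x : R) : R := ln x / ln 2.

Lemma MVT_ge0 (f f' : R -> R) (b : R) :
  0 <= b -> f 0 = 0 ->
  (forall c, 0 <= c <= b -> derivable_pt_lim f c (f' c)) ->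
  (forall c, 0 <= c <= b -> 0 <= f' c) -> 0 <= f b.
Proof.
  intros Hb H0 Hd Hp. destruct (Req_dec b 0) as [->|Hb0]; [lra|].
  destruct (MVT_cor2 f f' 0 b ltac:(lra) Hd) as [c [Hc Hcb]].
  specialize (Hp c ltac:(lra)). nra.
Qed.

(* Partial sums of the series of [2 artanh u]. *)
Lemma ln_artanh_bounds (u : R) :
  0 <= u <= 1 / 2 ->
  let s := 2 * (u + u ^ 3 / 3 + u ^ 5 / 5 + u ^ 7 / 7 + u ^ 9 / 9) in
  s <= ln ((1 + u) / (1 - u)) <= s + 8 / 33 * u ^ 11.
Proof.
  intros Hu s. unfold s. rewrite ln_div by lra. clear s.
  assert (Hden : forall c, 0 <= c <= u -> 0 < 1 - c * c) by (intros; nra).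
  assert (Hp : forall c : R, 0 <= c ^ 10)
    by (intros c; replace (c ^ 10) with ((c ^ 5) ^ 2) by ring; apply pow2_ge_0).
  split.
  - apply Rminus_le_0.
    apply (MVT_ge0 (fun u => ln (1 + u) - ln (1 - u)
             - 2 * (u + u ^ 3 / 3 + u ^ 5 / 5 + u ^ 7 / 7 + u ^ 9 / 9))
             (fun u => 2 * u ^ 10 / (1 - u * u))).
    + lra.
    + rewrite Rplus_0_r, Rminus_0_r. field.
    + intros c Hc. apply is_derive_Reals. specialize (Hden c Hc).
      auto_derive; [repeat split; lra|]. field. lra.
    + intros c Hc. specialize (Hden c Hc). specialize (Hp c).
      apply Rdiv_le_0_compat; lra.
  - apply Rminus_le_0.
    (* The tail has derivative 2 u^10 / (1 - u^2), at most (8/3) u^10 for u <= 1/2; integrating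
       gives 8/33. *)
    apply (MVT_ge0 (fun u => 2 * (u + u ^ 3 / 3 + u ^ 5 / 5 + u ^ 7 / 7 + u ^ 9 / 9)
             + 8 / 33 * u ^ 11 - (ln (1 + u) - ln (1 - u)))
             (fun u => 2 * u ^ 10 * ((1 - 4 * (u * u)) / (3 * (1 - u * u))))).
    + lra.
    + rewrite Rplus_0_r, Rminus_0_r. field.
    + intros c Hc. apply is_derive_Reals. specialize (Hden c Hc).
      auto_derive; [repeat split; lra|]. field. lra.
    + intros c Hc. specialize (Hden c Hc). specialize (Hp c).
      apply Rmult_le_pos; [lra|]. apply Rdiv_le_0_compat; nra.
Qed.

Lemma ln2_bounds : 693146 / 1000000 < ln 2 < 693149 / 1000000.
Proof.
  assert (H := ln_artanh_bounds (1 / 3) ltac:(lra)). cbv zeta in H.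
  replace ((1 + 1 / 3) / (1 - 1 / 3)) with 2 in H by field. lra.
Qed.

(** Since ln 2 < 1, the series is applied to reciprocals q > 1 of its rational bounds, with u =
    (q-1)/(q+1) so that u >= 0. *)
Lemma ln_ln2_bounds : - (366516 / 1000000) < ln (ln 2) < - (366510 / 1000000).
Proof.
  assert (H2 := ln2_bounds).
  assert (Hlo : ln (1000000 / 693146) < 366516 / 1000000).
  { assert (H := ln_artanh_bounds (306854 / 1693146) ltac:(lra)). cbv zeta in H.
    replace ((1 + 306854 / 1693146) / (1 - 306854 / 1693146))
      with (1000000 / 693146) in H by field. lra. }
  assert (Hhi : 366510 / 1000000 < ln (1000000 / 693149)).
  { assert (H := ln_artanh_bounds (306851 / 1693149) ltac:(lra)). cbv zeta in H.
    replace ((1 + 306851 / 1693149) / (1 - 306851 / 1693149))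
      with (1000000 / 693149) in H by field. lra. }
  split.
  - apply Rlt_trans with (ln (693146 / 1000000)); [|apply ln_increasing; lra].
    replace (693146 / 1000000) with (/ (1000000 / 693146)) by field.
    rewrite ln_Rinv by lra. lra.
  - apply Rlt_trans with (ln (693149 / 1000000)); [apply ln_increasing; lra|].
    replace (693149 / 1000000) with (/ (1000000 / 693149)) by field.
    rewrite ln_Rinv by lra. lra.
Qed.

Lemma t_inf_bounds : - (13852 / 10000) < t_inf <= - (13851 / 10000).
Proof.
  assert (H2 := ln2_bounds). assert (Hy := ln_ln2_bounds). unfold t_inf.
  assert (E : (1 + 2 * ln (ln 2)) / ln 2 * ln 2 = 1 + 2 * ln (ln 2))
    by (field; lra).
  split; nra.
Qed.

Lemma ln_le_sub1 (x : R) : 0 < x -> ln x <= x - 1.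
Proof.
  intros Hx. assert (H := exp_ineq1_le (ln x)). rewrite exp_ln in H; lra.
Qed.

(** The induction step reduces to (n+2) ln ((n+1)/(n+2)) <= -1, which is ln y <= y - 1. *)
Lemma ln_fact_le (n : nat) :
  ln (INR (fact n)) <= (INR n + 1) * ln (INR n + 1) - INR n.
Proof.
  induction n as [|n IH].
  - cbn. rewrite Rplus_0_l, ln_1. lra.
  - rewrite fact_simpl, mult_INR, ln_mult
      by (apply lt_0_INR; (apply lt_O_fact || lia)).
    rewrite S_INR. assert (Hn := pos_INR n).
    assert (H : ln ((INR n + 1) / (INR n + 1 + 1)) <= - / (INR n + 1 + 1)).
    { eapply Rle_trans; [apply ln_le_sub1, Rdiv_lt_0_compat; lra|].
      right. field. lra. }
    rewrite ln_div in H by lra.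
    assert (E : (INR n + 1 + 1) * / (INR n + 1 + 1) = 1) by (field; lra).
    nra.
Qed.

(** Tangent to 2 ln s at s = 7, where s = sqrt x: the constant is at least 2 ln 7 - 2. *)
Lemma ln_le_sqrt (x : R) : 49 <= x -> ln x <= 191 / 100 + 2 / 7 * sqrt x.
Proof.
  intros Hx. assert (Hs : 0 < sqrt x) by (apply sqrt_lt_R0; lra).
  assert (H7 : ln 7 <= 1955 / 1000).
  { replace 7 with (2 * 2 * 2 * (7 / 8)) by field.
    rewrite !ln_mult by lra. assert (H := ln_le_sub1 (7 / 8) ltac:(lra)).
    assert (H2 := ln2_bounds). lra. }
  assert (H := ln_le_sub1 (sqrt x / 7) ltac:(lra)).
  rewrite ln_div in H by lra.
  rewrite <- (sqrt_sqrt x) at 1 by lra. rewrite ln_mult by lra. lra.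
Qed.

Lemma log2R_bounds (n : R) :
  49 <= n ->
  1 <= log2R n /\ 4 * log2R n <= n /\ 2 * log2R n ^ 2 < (n - 1) / ln 2.
Proof.
  intros Hn. assert (H2 := ln2_bounds). assert (H := ln_le_sqrt n Hn).
  assert (Hs : 7 <= sqrt n).
  { rewrite <- (sqrt_square 7) by lra. apply sqrt_le_1_alt. lra. }
  assert (Hss := sqrt_sqrt n ltac:(lra)).
  assert (E : log2R n * ln 2 = ln n) by (unfold log2R; field; lra).
  assert (E1 : (n - 1) / ln 2 * ln 2 = n - 1) by (field; lra).
  set (s := sqrt n) in *. set (a := log2R n) in *.
  assert (Hln : ln 2 < ln n) by (apply ln_increasing; lra).
  assert (H1 : 1 <= a) by nra.
  (* The third claim amounts to 2 (ln n)^2 < (n - 1) ln 2; replacing ln n by its bound from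
     [ln_le_sqrt] leaves a quadratic in s >= 7. *)
  assert (Hsa : 0 <= s * s - 1 - 2 / (693146 / 1000000) * (191 / 100 + 2 / 7 * s) ^ 2)
    by nra.
  split; [exact H1|split].
  - assert (a * (693146 / 1000000) <= ln n) by nra. nra.
  - assert (Hl2 : ln n ^ 2 <= (191 / 100 + 2 / 7 * s) ^ 2)
      by (apply pow_incr; lra).
    apply Rmult_lt_reg_r with (ln 2 ^ 2); [apply pow_lt; lra|].
    replace (2 * a ^ 2 * ln 2 ^ 2) with (2 * ln n ^ 2) by (rewrite <- E; ring).
    replace ((n - 1) / ln 2 * ln 2 ^ 2) with ((n - 1) * ln 2) by (field; lra).
    nra.
Qed.

(** * Inequalities between n = A + 1 and x = log2 (B+1) *)

Lemma solution_inequality (A B C : nat) :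
  nontrivial_solution A B C ->
  let n := INR A + 1 in let a := log2R n in let x := log2R (INR B + 1) in
  a <= x /\ (n - a - x) * x <= n * a - (n - 1) / ln 2.
Proof.
  intros (HA & _ & _ & HAB & HBC & E0) n a x.
  assert (H2 := ln2_bounds).
  assert (HAR : 0 < INR A) by (now apply lt_0_INR).
  assert (HABR : INR A <= INR B) by (now apply le_INR).
  assert (Ea : a * ln 2 = ln n) by (unfold a, log2R; field; lra).
  assert (Ex : x * ln 2 = ln (INR B + 1)) by (unfold x, log2R; field; lra).
  assert (Hax : a <= x).
  { apply Rmult_le_reg_r with (ln 2); [lra|]. rewrite Ea, Ex.
    apply ln_le; unfold n; lra. }
  split; [exact Hax|].
  remember (C - B)%nat as k eqn:Hk.
  assert (HC : C = (B + k)%nat) by lia. rewrite HC in E0.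
  assert (HkA := solution_k_lt A B k HA HAB E0).
  (* k < A <= B gives B + k <= 2 (B + 1); the factor 2 turns 2^(k-2) into 2^(k-1). *)
  assert (Hval : (2 ^ A <= (A + 1) * (2 ^ (k - 1) * (B + 1)))%nat).
  { eapply Nat.le_trans; [apply v2fact_lower|]. apply Nat.mul_le_mono_l.
    eapply Nat.le_trans; [apply (solution_v2 A B k); [lia|exact E0]|].
    replace (k - 1)%nat with (S (k - 2)) by lia. rewrite Nat.pow_succ_r'. nia. }
  assert (HK : n - a - x <= INR k).
  { apply le_INR in Hval. rewrite !mult_INR, !pow_INR, !plus_INR in Hval.
    change (INR 2) with 2 in Hval. change (INR 1) with 1 in Hval.
    assert (P1 := pow_lt 2 A ltac:(lra)).
    assert (P2 := pow_lt 2 (k - 1) ltac:(lra)).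
    apply ln_le in Hval; [|exact P1].
    rewrite !ln_mult, !ln_pow in Hval by (try apply Rmult_lt_0_compat; lra).
    rewrite minus_INR in Hval by lia. change (INR 1) with 1 in Hval.
    fold n in Hval. rewrite <- Ea, <- Ex in Hval. unfold n in *. nra. }
  assert (Hpow : INR k * x <= n * a - (n - 1) / ln 2).
  { assert (H := solution_pow_le A B k E0). apply le_INR in H.
    rewrite pow_INR, plus_INR in H. change (INR 1) with 1 in H.
    apply ln_le in H; [|apply pow_lt; lra]. rewrite ln_pow in H by lra.
    assert (HF := ln_fact_le A). fold n in HF. rewrite <- Ex in H.
    rewrite <- Ea in HF.
    apply Rmult_le_reg_r with (ln 2); [lra|].
    replace ((n * a - (n - 1) / ln 2) * ln 2) with (n * (a * ln 2) - (n - 1))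
      by (field; lra).
    unfold n in *. lra. }
  (* Hence x >= a >= 0, so [HK] may be multiplied by x. *)
  assert (Ha : 0 <= a).
  { apply Rmult_le_reg_r with (ln 2); [lra|]. rewrite Ea, Rmult_0_l, <- ln_1.
    apply ln_le; unfold n; lra. }
  nra.
Qed.

(** With a = [log2R n], (x - a)(n - x - 2a) = (n - a - x) x - n a + 2 a^2. This is negative by
    [log2R_bounds] while x >= a, so n < x + 2a; then 4a <= n yields n <= 2x. *)
Lemma log2R_lt (n x : R) :
  49 <= n -> log2R n <= x ->
  (n - log2R n - x) * x <= n * log2R n - (n - 1) / ln 2 ->
  (x - log2R n) * (n - x - 2 * log2R n) <= 2 * log2R n ^ 2 - (n - 1) / ln 2 /\
  n < x + 2 * log2R n /\ n <= 2 * x.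
Proof.
  intros Hn Hax H. destruct (log2R_bounds n Hn) as (H1 & H4 & Hlt).
  set (a := log2R n) in *.
  assert (Hc : (x - a) * (n - x - 2 * a) <= 2 * a ^ 2 - (n - 1) / ln 2) by nra.
  assert (n < x + 2 * a) by nra.
  repeat split; [exact Hc|assumption|lra].
Qed.

Lemma log2R_le_double (n x : R) : 0 < n -> n <= 2 * x -> log2R n <= 1 + log2R x.
Proof.
  intros Hn Hx. assert (H2 := ln2_bounds). unfold log2R.
  apply Rmult_le_reg_r with (ln 2); [lra|].
  replace (ln n / ln 2 * ln 2) with (ln n) by (field; lra).
  replace ((1 + ln x / ln 2) * ln 2) with (ln 2 + ln x) by (field; lra).
  rewrite <- ln_mult by lra. apply ln_le; lra.
Qed.

(** With q = n^(1/4), ln n = 4 ln q <= 4q, so (ln n)^2 <= 16 sqrt n <= 16 * 1.415 sqrt x; dividing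
    by (ln 2)^2 > 0.48 gives less than 48. *)
Lemma log2R_sqr_le (n x : R) :
  49 <= n -> n <= 2 * x -> log2R n ^ 2 <= 48 * sqrt x.
Proof.
  intros Hn Hx. assert (H2 := ln2_bounds).
  set (q := sqrt (sqrt n)).
  assert (Hs : 0 < sqrt n) by (apply sqrt_lt_R0; lra).
  assert (Hq : 0 < q) by (apply sqrt_lt_R0; lra).
  assert (Eq : q * q = sqrt n) by (apply sqrt_sqrt; lra).
  assert (Hln : ln n <= 4 * q).
  { assert (H := ln_le_sub1 q Hq).
    rewrite <- (sqrt_sqrt n) by lra. rewrite <- Eq, !ln_mult by nra. lra. }
  assert (Hln0 : 0 <= ln n) by (rewrite <- ln_1; apply ln_le; lra).
  assert (Hsx : sqrt n <= 1415 / 1000 * sqrt x).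
  { apply Rle_trans with (sqrt (2 * x)); [apply sqrt_le_1_alt; lra|].
    rewrite sqrt_mult by lra. apply Rmult_le_compat_r; [apply sqrt_pos|].
    rewrite <- (sqrt_square (1415 / 1000)) by lra. apply sqrt_le_1_alt. lra. }
  assert (Hl2 : ln n ^ 2 <= 16 * sqrt n) by nra.
  assert (Hx0 := sqrt_pos x).
  unfold log2R. apply Rmult_le_reg_r with (ln 2 ^ 2); [apply pow_lt; lra|].
  replace ((ln n / ln 2) ^ 2 * ln 2 ^ 2) with (ln n ^ 2) by (field; lra).
  assert (48 / 100 < ln 2 ^ 2) by nra. nra.
Qed.

(** Sharpens n < x + 2a, a = [log2R n], in two ways: the term (n - 1) / ln 2 saves 1 / ln 2, and a
    is replaced by [log2R x]; the errors are O(a^2 / x). *)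
Lemma log2R_asymptotic (n x e : R) :
  0 < e -> 49 <= n -> log2R n <= x ->
  (n - log2R n - x) * x <= n * log2R n - (n - 1) / ln 2 ->
  (480 / e) ^ 2 <= x -> n <= x + 2 * log2R x + e - 1 / ln 2.
Proof.
  intros He Hn Hax H Hxe. assert (H2 := ln2_bounds).
  destruct (log2R_lt n x Hn Hax H) as (Hc & Hlt & Hnx).
  destruct (log2R_bounds n Hn) as (H1 & H4 & _).
  assert (Hinv : 1 / ln 2 < 2).
  { apply Rmult_lt_reg_r with (ln 2); [lra|].
    replace (1 / ln 2 * ln 2) with 1 by (field; lra). lra. }
  assert (Hdiv : (n - 1) / ln 2 = (n - 1) * (1 / ln 2)) by (field; lra).
  assert (Hi0 : 0 < 1 / ln 2) by (apply Rdiv_lt_0_compat; lra).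
  assert (Hlx : 1 <= log2R x).
  { unfold log2R. apply Rmult_le_reg_r with (ln 2); [lra|].
    replace (ln x / ln 2 * ln 2) with (ln x) by (field; lra).
    rewrite Rmult_1_l. apply ln_le; lra. }
  destruct (Rle_lt_dec n x) as [Hle|Hgt]; [lra|].
  assert (Hsq := log2R_sqr_le n x Hn Hnx).
  (* ln (n/x) <= n/x - 1 < 2a/x, and 2 / ln 2 < 3. *)
  assert (Hlog : log2R n <= log2R x + 3 * log2R n / x).
  { assert (Hr := ln_le_sub1 (n / x) ltac:(apply Rdiv_lt_0_compat; lra)).
    rewrite ln_div in Hr by lra.
    assert (Hr2 : n / x - 1 <= 2 * log2R n / x).
    { apply Rmult_le_reg_r with x; [lra|].
      replace ((n / x - 1) * x) with (n - x) by (field; lra).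
      replace (2 * log2R n / x * x) with (2 * log2R n) by (field; lra). lra. }
    assert (Hp : 0 < log2R n / x) by (apply Rdiv_lt_0_compat; lra).
    replace (3 * log2R n / x) with (3 * (log2R n / x)) by (field; lra).
    replace (2 * log2R n / x) with (2 * (log2R n / x)) in Hr2 by (field; lra).
    assert (E1 : log2R n * ln 2 = ln n) by (unfold log2R; field; lra).
    assert (E2 : log2R x * ln 2 = ln x) by (unfold log2R; field; lra).
    apply Rmult_le_reg_r with (ln 2); [lra|].
    set (p := log2R n / x) in *. nra. }
  set (a := log2R n) in *. set (i := 1 / ln 2) in *.
  (* Divide the factored inequality by x - a, using n - 1 >= x - a (as n > x and a >= 1) and x - a
     >= x/2 (as 4a <= n <= 2x). *)
  assert (Hquot : n - x - 2 * a <= 4 * a ^ 2 / x - i).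
  { assert (Hxa : x / 2 <= x - a) by lra.
    apply Rmult_le_reg_l with (x - a); [lra|].
    apply Rle_trans with (2 * a ^ 2 - (x - a) * i); [nra|].
    assert (0 <= 4 * a ^ 2 / x) by (apply Rdiv_le_0_compat; nra).
    assert (4 * a ^ 2 / x * (x / 2) = 2 * a ^ 2) by (field; lra).
    nra. }
  (* As a >= 1, the sum is at most 10 a^2 / x <= 480 / sqrt x, whence the threshold (480 / e)^2. *)
  assert (Herr : 6 * a / x + 4 * a ^ 2 / x <= e).
  { set (r := sqrt x) in *.
    assert (Hr : 0 < r) by (apply sqrt_lt_R0; lra).
    assert (Err : r * r = x) by (apply sqrt_sqrt; lra).
    assert (Hre : 480 / e <= r).
    { unfold r. rewrite <- (sqrt_pow2 (480 / e)).
      - now apply sqrt_le_1_alt.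
      - apply Rlt_le, Rdiv_lt_0_compat; lra. }
    assert (Hre2 : 480 <= e * r).
    { apply Rmult_le_reg_r with (/ e); [now apply Rinv_0_lt_compat|].
      replace (e * r * / e) with r by (field; lra). exact Hre. }
    apply Rmult_le_reg_r with x; [lra|].
    replace ((6 * a / x + 4 * a ^ 2 / x) * x) with (6 * a + 4 * a ^ 2)
      by (field; lra).
    rewrite <- Err. nra. }
  replace (3 * a / x) with (6 * a / x / 2) in Hlog by (field; lra). lra.
Qed.

(** * Conclusion in terms of [upper_bound] *)

(** ln (ln (B+1)) = ln x + ln (ln 2) for x = log2 (B+1); this is the source of ln (ln 2) in
    [t_inf]. *)
Lemma upper_bound_log2R (B : nat) (t : R) :
  (0 < B)%nat ->
  upper_bound B t = log2R (INR B + 1) + 2 * log2R (log2R (INR B + 1))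
                    + 2 * ln (ln 2) / ln 2 + t.
Proof.
  intros HB. assert (H2 := ln2_bounds). apply lt_0_INR in HB.
  assert (Hl : 0 < ln (INR B + 1)) by (rewrite <- ln_1; apply ln_increasing; lra).
  unfold upper_bound, log2R. rewrite (ln_div (ln (INR B + 1))) by lra.
  field. lra.
Qed.

Lemma log2R_pow2 (m : nat) : log2R (2 ^ m) = INR m.
Proof.
  assert (H2 := ln2_bounds). unfold log2R. rewrite ln_pow by lra. field. lra.
Qed.

Theorem theorem1 :
  (- (13852 / 10000) < t_inf <= - (13851 / 10000)) /\
  (forall t : R, t > t_inf ->
     exists B0 : nat, forall A B C : nat,
       nontrivial_solution A B C -> (A, B, C) <> (6, 7, 10)%nat ->
       (B0 <= B)%nat ->
       INR A <= upper_bound B t) /\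
  (forall A B C : nat,
     nontrivial_solution A B C -> (A, B, C) <> (6, 7, 10)%nat ->
     INR A <= upper_bound B (21221 / 10000)).
Proof.
  assert (H2 := ln2_bounds).
  assert (H49 : forall A B C, nontrivial_solution A B C ->
    (A, B, C) <> (6, 7, 10)%nat -> 49 <= INR A + 1).
  { intros A B C Hs Hne. assert (H := nontrivial_solution_large A B C Hs Hne).
    apply le_INR in H. replace (INR 48) with 48 in H by (cbn; lra). lra. }
  split; [exact t_inf_bounds|split].
  - intros t Ht.
    assert (He : 0 < t - t_inf) by lra.
    (* [log2R_asymptotic] is used with e = t - [t_inf]; B >= 2^m ensures x >= m. *)
    destruct (INR_unbounded ((480 / (t - t_inf)) ^ 2)) as [m Hm].
    exists (2 ^ m)%nat. intros A B C Hs Hne HB.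
    destruct (solution_inequality A B C Hs) as [Hax Hin].
    rewrite upper_bound_log2R by (destruct Hs; lia).
    assert (Hx : INR m <= log2R (INR B + 1)).
    { rewrite <- log2R_pow2. unfold log2R. apply Rmult_le_compat_r.
      - apply Rlt_le, Rinv_0_lt_compat. lra.
      - apply ln_le; [apply pow_lt; lra|]. apply le_INR in HB.
        rewrite pow_INR in HB. change (INR 2) with 2 in HB. lra. }
    assert (H := log2R_asymptotic _ _ _ He (H49 A B C Hs Hne) Hax Hin ltac:(lra)).
    unfold t_inf in H.
    replace ((1 + 2 * ln (ln 2)) / ln 2) with (1 / ln 2 + 2 * ln (ln 2) / ln 2)
      in H by (field; lra).
    lra.
  - intros A B C Hs Hne.
    destruct (solution_inequality A B C Hs) as [Hax Hin].
    rewrite upper_bound_log2R by (destruct Hs; lia).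
    assert (Hn := H49 A B C Hs Hne).
    destruct (log2R_lt _ _ Hn Hax Hin) as (_ & Hlt & Hnx).
    assert (Hd := log2R_le_double (INR A + 1) _ ltac:(lra) Hnx).
    assert (Hy := ln_ln2_bounds).
    (* Since A = n - 1 < x + 2 log2 x + 1, it remains to see 1 <= 2 ln (ln 2) / ln 2 + 2.1221, and
       2.1221 - 1.1 > 1. *)
    assert (Hc : - (11 / 10) <= 2 * ln (ln 2) / ln 2).
    { apply Rmult_le_reg_r with (ln 2); [lra|].
      replace (2 * ln (ln 2) / ln 2 * ln 2) with (2 * ln (ln 2)) by (field; lra).
      lra. }
    lra.
Qed.
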